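(* Let $K\subset\mathbb{H}^2$ be a convex body of constant width $w$, containing the origin $O$ in its interior, and such that $\partial K$ is a $C^1$-smooth curve. If the sections $K\cap\Gamma$ of $K$ by all geodesics $\Gamma$ passing through $O$ have the same length, then $K$ is a disc.
   Context: $\mathbb{H}^2$ is the hyperbolic plane and $O\in\mathbb{H}^2$ is a fixed point, called the origin (e.g. the center of the Poincaré disc model). A body is a compact set $K\subset\mathbb{H}^2$ equal to the closure of its non-empty interior. It is convex if its boundary cannot be intersected by a geodesic in more than two points (with the exception that an arc of a geodesic may be part of the boundary). A supporting geodesic of $K$ is a geodesic that has only one common point with $\partial K$, or has a complete arc in common with $\partial K$. A disc is a closed hyperbolic metric ball of positive radius (not assumed in advance to be centered at $O$). Lengths are hyperbolic lengths of geodesic segments; geodesics are complete lines. Width: for $K$ with $C^1$-smooth boundary and $x\in\partial K$, $n_K(x)$ denotes the geodesic through $x$ perpendicular to the supporting geodesic of $K$ at $x$. Let $\Gamma_2$ be the other supporting geodesic of $K$ (different from the one at $x$) that is orthogonal to $n_K(x)$, and let $\phi(x)$ be the intersection point of $n_K(x)$ and $\Gamma_2$. The width of $K$ at $x$ is $w_K(x)=\big|[x,\phi(x)]\big|$, the hyperbolic length of the geodesic segment $[x,\phi(x)]$. $K$ has constant width $w$ if $w_K(x)=w$ for all $x\in\partial K$. *)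

(* Defs.v *)
From HB Require Import structures.
From mathcomp Require Import all_boot all_order all_algebra.
From mathcomp Require Import all_classical all_reals all_analysis.

Set Implicit Arguments.
Unset Strict Implicit.
Unset Printing Implicit Defensive.

Import Order.TTheory GRing.Theory Num.Theory.
Import numFieldNormedType.Exports.

Local Open Scope classical_set_scope.
Local Open Scope ring_scope.

(* The hyperbolic plane is the upper sheet of the hyperboloid
   x1 ^ 2 + x2 ^ 2 - x0 ^ 2 = -1 in R^3, with the induced topology. *)

Definition mink (R : realType) (u v : 'rV[R]_3) : R :=
  u 0 1 * v 0 1 + u 0 2 * v 0 2 - u 0 0 * v 0 0.

Definition hyperboloid (R : realType) : set 'rV[R]_3 :=
  [set p | mink p p = -1 /\ 0 < p 0 0].

(* A notation, so that the topology of a subtype is found on it. *)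
Notation hplane R := (set_type (@hyperboloid R)).

Definition cosh (R : realType) (t : R) : R := (expR t + expR (- t)) / 2.
Definition sinh (R : realType) (t : R) : R := (expR t - expR (- t)) / 2.
(* meaningful for 1 <= x *)
Definition arcosh (R : realType) (x : R) : R := ln (x + Num.sqrt (x ^+ 2 - 1)).

Definition hdist (R : realType) (p q : hplane R) : R :=
  arcosh (- mink (set_val p) (set_val q)).

Definition unit_tangent (R : realType) (p : hplane R) (u : 'rV[R]_3) : Prop :=
  mink (set_val p) u = 0 /\ mink u u = 1.

Definition geodesic_at (R : realType) (p : hplane R) (u : 'rV[R]_3)
  : set (hplane R) :=
  [set q | exists t : R, set_val q = cosh t *: set_val p + sinh t *: u].

Definition geodesic (R : realType) (G : set (hplane R)) : Prop :=
  exists (p : hplane R) (u : 'rV[R]_3), unit_tangent p u /\ G = geodesic_at p u.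

(* The tangent plane at p carries the restriction of mink as its Riemannian
   inner product. *)
Definition perpendicular (R : realType) (G1 G2 : set (hplane R)) : Prop :=
  exists (p : hplane R) (u v : 'rV[R]_3),
    [/\ unit_tangent p u, unit_tangent p v, mink u v = 0,
        G1 = geodesic_at p u & G2 = geodesic_at p v].

Definition segment (R : realType) (a b : hplane R) : set (hplane R) :=
  [set c | hdist a c + hdist c b = hdist a b].

Definition segment_of_length (R : realType) (S : set (hplane R)) (l : R) : Prop :=
  exists a b : hplane R, S = segment a b /\ hdist a b = l.

Definition boundary (T : topologicalType) (K : set T) : set T :=
  closure K `\` interior K.

Definition body (R : realType) (K : set (hplane R)) : Prop :=
  [/\ compact K, interior K !=set0 & K = closure (interior K)].

(* A geodesic meets the boundary in at most two points, or in an arc. *)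
Definition hconvex (R : realType) (K : set (hplane R)) : Prop :=
  forall G : set (hplane R), geodesic G ->
    (forall p q r : hplane R,
       (G `&` boundary K) p -> (G `&` boundary K) q -> (G `&` boundary K) r ->
       [\/ p = q, p = r | q = r]) \/
    (exists a b : hplane R, a <> b /\ G `&` boundary K = segment a b).

Definition convex_body (R : realType) (K : set (hplane R)) : Prop :=
  body K /\ hconvex K.

Definition supporting (R : realType) (K G : set (hplane R)) : Prop :=
  geodesic G /\
  ((exists p : hplane R, G `&` boundary K = [set p]) \/
   (exists a b : hplane R, a <> b /\ G `&` boundary K = segment a b)).

(* A regular simple closed curve of class C^1, parametrized with period 1;
   derivatives are taken in the ambient space R^3. *)
Definition C1_closed_curve (R : realType) (C : set (hplane R)) : Prop :=
  exists g : R -> hplane R,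
    let f : R -> 'rV[R]_3 := fun t => set_val (g t) in
    [/\ forall t : R, derivable f t 1,
        continuous (derive1 f),
        forall t : R, derive1 f t != 0,
        (forall t : R, g (t + 1) = g t) /\
        (forall s t : R, 0 <= s < 1 -> 0 <= t < 1 -> g s = g t -> s = t)
      & range g = C].

(* G1 is the supporting geodesic at x, N is n_K(x), G2 the other supporting
   geodesic orthogonal to N, and y is phi(x). *)
Definition is_width (R : realType) (K : set (hplane R)) (x : hplane R) (l : R)
  : Prop :=
  exists (G1 N G2 : set (hplane R)) (y : hplane R),
    [/\ supporting K G1 /\ G1 x,
        N x /\ perpendicular N G1,
        [/\ supporting K G2, G2 <> G1 & perpendicular N G2],
        (N `&` G2) y
      & hdist x y = l].

(* Equality with a singleton: the width at x is well defined, and equal to w. *)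
Definition constant_width (R : realType) (K : set (hplane R)) (w : R) : Prop :=
  forall x : hplane R, boundary K x -> [set l | is_width K x l] = [set w].

Definition disc (R : realType) (K : set (hplane R)) : Prop :=
  exists (c : hplane R) (r : R), 0 < r /\ K = [set p | hdist c p <= r].

(* Main.v *)
Require Import Defs.
From HB Require Import structures.
From mathcomp Require Import all_boot all_order all_algebra.
From mathcomp Require Import all_classical all_reals all_analysis.
From mathcomp Require Import ring lra.

(** In the hyperboloid model the distance of [p] and [q] is determined by
    [cosh (hdist p q) = - mink p q], and a geodesic through [p] with unit
    tangent vector [u] is [t |-> cosh t *: p + sinh t *: u].

    The body [K] turns out to be a disc because every chord through [O] is a
    diameter of [K], that is, realizes the largest distance between points of
    [K].  This follows from two computations of the width [w].

    On the one hand, let [p] and [q] be the ends of a diameter.  As [q] is a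
    point of [K] farthest from [p], the perpendicular to [pq] at [q] meets [K]
    only at [q] ([supporting_farthest]), and likewise at [p].  These are two
    supporting geodesics with common perpendicular [pq], so [w] is the diameter
    of [K] ([diameter_width]).

    On the other hand, let [x] be a point of [K] farthest from [O], and [z] the
    other end of the chord through [x] and [O].  All chords through [O] have the
    same length [l], so [z] is a boundary point nearest to [O].  The
    perpendicular to the chord at [x] is a supporting geodesic as before; the
    perpendicular at [z] is tangent to a disc around [O] contained in [K], and
    the convexity of [K] makes it a supporting geodesic too
    ([supporting_nearest]).  Hence [w = l] ([chord_width]).

    So all chords through [O] have the length of a diameter.  Let [x] and [x']
    be the ends of such a chord.  The boundary, which is a differentiable curve,
    maximizes the distance from [x'] when it passes through [x], so its velocity
    there is orthogonal to [x'].  The velocity is orthogonal to [x] as well,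
    since the curve runs on the hyperboloid, and thus to [O], which lies between
    [x] and [x'].  Therefore the distance from [O] is constant along the
    boundary, and [K] is a disc around [O] ([disc_of_boundary]). *)

Set Implicit Arguments.
Unset Strict Implicit.
Unset Printing Implicit Defensive.

Import Order.TTheory GRing.Theory Num.Theory.
Import numFieldNormedType.Exports.

Local Open Scope classical_set_scope.
Local Open Scope ring_scope.

(** * Hyperbolic functions *)

Section Hyperbolic.
Context {R : realType}.
Implicit Types s t c : R.

Lemma cosh0 : cosh 0 = 1 :> R.
Proof. by rewrite /cosh oppr0 expR0; lra. Qed.

Lemma sinh0 : sinh 0 = 0 :> R.
Proof. by rewrite /sinh oppr0 subrr mul0r. Qed.

Lemma coshN t : cosh (- t) = cosh t.
Proof. by rewrite /cosh opprK addrC. Qed.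

Lemma sinhN t : sinh (- t) = - sinh t.
Proof. by rewrite /sinh opprK -mulNr opprB. Qed.

Lemma coshD s t : cosh (s + t) = cosh s * cosh t + sinh s * sinh t.
Proof. by rewrite /cosh /sinh opprD !expRD; field. Qed.

Lemma sinhD s t : sinh (s + t) = sinh s * cosh t + cosh s * sinh t.
Proof. by rewrite /cosh /sinh opprD !expRD; field. Qed.

Lemma coshB s t : cosh (s - t) = cosh s * cosh t - sinh s * sinh t.
Proof. by rewrite coshD coshN sinhN mulrN. Qed.

Lemma sinhB s t : sinh (s - t) = sinh s * cosh t - cosh s * sinh t.
Proof. by rewrite sinhD coshN sinhN mulrN. Qed.

Lemma cosh2_sinh2 t : cosh t ^+ 2 - sinh t ^+ 2 = 1.
Proof. by rewrite !expr2 -coshB subrr cosh0. Qed.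

Lemma cosh_gt0 t : 0 < cosh t.
Proof. by rewrite /cosh divr_gt0// addr_gt0 ?expR_gt0. Qed.

Lemma sinh_gt0 t : 0 < t -> 0 < sinh t.
Proof. by move=> t0; rewrite /sinh divr_gt0// subr_gt0 ltr_expR; lra. Qed.

Lemma cosh_abs t : cosh `|t| = cosh t.
Proof. by case: (ger0P t) => _ //; rewrite coshN. Qed.

Lemma ltr_cosh s t : (cosh s < cosh t) = (`|s| < `|t|).
Proof.
have H (a b : R) : `|a| < `|b| -> cosh a < cosh b.
  move=> ab; rewrite -(cosh_abs a) -(cosh_abs b).
  have := normr_ge0 a; move: ab; move: `|a| `|b| => {}a {}b ab a0.
  have := coshB ((b + a) / 2) ((b - a) / 2).
  have := coshD ((b + a) / 2) ((b - a) / 2).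
  rewrite (_ : (b + a) / 2 + (b - a) / 2 = b); last by field.
  rewrite (_ : _ - (b - a) / 2 = a); last by field.
  have := @sinh_gt0 ((b + a) / 2) ltac:(lra).
  have := @sinh_gt0 ((b - a) / 2) ltac:(lra).
  by nra.
apply/idP/idP; last exact: H.
move=> st; rewrite ltNge; apply/negP; rewrite le_eqVlt => /orP[/eqP ts|/H].
  by move: st; rewrite -(cosh_abs s) -(cosh_abs t) ts ltxx.
by rewrite ltNge ltW.
Qed.

Lemma ler_cosh s t : (cosh s <= cosh t) = (`|s| <= `|t|).
Proof. by rewrite !leNgt ltr_cosh. Qed.

Lemma cosh_ge1 t : 1 <= cosh t.
Proof. by rewrite -cosh0 ler_cosh normr0. Qed.

Lemma arcosh_ge0 c : 1 <= c -> 0 <= arcosh c.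
Proof. by move=> c1; rewrite ln_ge0// (le_trans c1)// lerDl sqrtr_ge0. Qed.

Lemma arcoshK c : 1 <= c -> cosh (arcosh c) = c.
Proof.
move=> c1; have r0 := sqrtr_ge0 (c ^+ 2 - 1).
have r2 : Num.sqrt (c ^+ 2 - 1) ^+ 2 = c ^+ 2 - 1 by rewrite sqr_sqrtr//; nra.
rewrite /cosh expRN lnK ?posrE; last by nra.
by move: (Num.sqrt _) r0 r2 => r r0 r2; field: r2; nra.
Qed.

Lemma coshK t : arcosh (cosh t) = `|t|.
Proof.
apply/eqP; rewrite eq_le -[X in X <= _]ger0_norm ?arcosh_ge0 ?cosh_ge1//.
rewrite -ler_cosh arcoshK ?cosh_ge1// lexx/=.
rewrite -[X in _ <= X]ger0_norm ?arcosh_ge0 ?cosh_ge1//.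
by rewrite -ler_cosh arcoshK ?cosh_ge1.
Qed.

Lemma continuous_cosh : continuous (@cosh R).
Proof.
move=> t; apply: cvgM; last exact: cvg_cst.
apply: cvgD; first exact: continuous_expR.
by apply: continuous_comp; [exact: opp_continuous|exact: continuous_expR].
Qed.

Lemma continuous_sinh : continuous (@sinh R).
Proof.
move=> t; apply: cvgM; last exact: cvg_cst.
apply: cvgB; first exact: continuous_expR.
by apply: continuous_comp; [exact: opp_continuous|exact: continuous_expR].
Qed.

End Hyperbolic.

(** * The Minkowski form *)

Section Minkowski.
Context {R : realType}.
Implicit Types (u v x : 'rV[R]_3) (a : R).

Lemma minkC u v : mink u v = mink v u.
Proof. by rewrite /mink; ring. Qed.

Lemma minkDl u v x : mink (u + v) x = mink u x + mink v x.
Proof. by rewrite /mink !mxE; ring. Qed.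

Lemma minkZl a u x : mink (a *: u) x = a * mink u x.
Proof. by rewrite /mink !mxE; ring. Qed.

Lemma minkDr u v x : mink x (u + v) = mink x u + mink x v.
Proof. by rewrite minkC minkDl !(minkC x). Qed.

Lemma minkZr a u x : mink x (a *: u) = a * mink x u.
Proof. by rewrite minkC minkZl minkC. Qed.

Definition minkE := (minkDl, minkDr, minkZl, minkZr).

Lemma rV3_eq u v :
  u 0 0 = v 0 0 -> u 0 1 = v 0 1 -> u 0 2 = v 0 2 -> u = v.
Proof.
move=> e0 e1 e2; apply/rowP => -[[|[|[|//]]] i3].
- by rewrite (_ : Ordinal _ = 0)//; exact/val_inj.
- by rewrite (_ : Ordinal _ = 1)//; exact/val_inj.
- by rewrite (_ : Ordinal _ = 2)//; exact/val_inj.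
Qed.

End Minkowski.

(** * Points and geodesics of the hyperboloid *)

Section Points.
Context {R : realType}.
Implicit Types (p q : hplane R) (u v : 'rV[R]_3) (s t : R).

Lemma minkpp p : mink (set_val p) (set_val p) = -1.
Proof. by case: (set_valP p). Qed.

Lemma coord0_gt0 p : 0 < set_val p 0 0.
Proof. by case: (set_valP p). Qed.

Lemma hplane_inj p q : set_val p = set_val q -> p = q.
Proof. exact: val_inj. Qed.

(** The reversed Cauchy-Schwarz inequality: with [p'] and [q'] the last two
    coordinates, it reads [1 + p' . q' <= sqrt (1 + |p'|^2) sqrt (1 + |q'|^2)],
    and the difference of the squares is a sum of squares. *)
Lemma mink_ge1 p q : 1 <= - mink (set_val p) (set_val q).
Proof.
have := minkpp p; have := minkpp q; have := coord0_gt0 p; have := coord0_gt0 q.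
rewrite /mink; move: (set_val p) (set_val q) => P Q.
move: (P 0 0) (P 0 1) (P 0 2) (Q 0 0) (Q 0 1) (Q 0 2) => a b c d e f d0 a0 hq hp.
have ad0 : 0 < a * d by rewrite mulr_gt0.
have H : (1 + b * e + c * f) ^+ 2 <= (a * d) ^+ 2.
  have -> : (a * d) ^+ 2 = (1 + b ^+ 2 + c ^+ 2) * (1 + e ^+ 2 + f ^+ 2).
    by rewrite exprMn; congr (_ * _); lra.
  by have := sqr_ge0 (b - e); have := sqr_ge0 (c - f);
     have := sqr_ge0 (b * f - c * e); nra.
have : 1 + b * e + c * f <= a * d by nra.
lra.
Qed.

(** The case of equality: each of the squares in that sum vanishes. *)
Lemma mink_eqN1 p q : mink (set_val p) (set_val q) = -1 -> p = q.
Proof.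
have := minkpp p; have := minkpp q; have := coord0_gt0 p; have := coord0_gt0 q.
rewrite /mink => d0 a0 hq hp pq; apply: hplane_inj.
move: (set_val p) (set_val q) d0 a0 hp hq pq => P Q.
move: (P 0 0) (P 0 1) (P 0 2) (Q 0 0) (Q 0 1) (Q 0 2) (@rV3_eq _ P Q).
move=> a b c d e f h d0 a0 hp hq pq.
have H : (b - e) ^+ 2 + (c - f) ^+ 2 + (b * f - c * e) ^+ 2 = 0.
  have -> : (b - e) ^+ 2 + (c - f) ^+ 2 + (b * f - c * e) ^+ 2 =
     (1 + b ^+ 2 + c ^+ 2) * (1 + e ^+ 2 + f ^+ 2) - (1 + b * e + c * f) ^+ 2.
    by ring.
  have -> : 1 + b ^+ 2 + c ^+ 2 = a ^+ 2 by lra.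
  have -> : 1 + e ^+ 2 + f ^+ 2 = d ^+ 2 by lra.
  have -> : 1 + b * e + c * f = a * d by lra.
  by ring.
have be : b = e.
  by apply/eqP; rewrite -subr_eq0 -sqrf_eq0; apply/eqP;
     have := sqr_ge0 (b - e); have := sqr_ge0 (c - f);
     have := sqr_ge0 (b * f - c * e); lra.
have cf : c = f.
  by apply/eqP; rewrite -subr_eq0 -sqrf_eq0; apply/eqP;
     have := sqr_ge0 (b - e); have := sqr_ge0 (c - f);
     have := sqr_ge0 (b * f - c * e); lra.
apply: h => //; subst e f.
have : (a - d) * (a + d) = 0 by lra.
by move=> /eqP; rewrite mulf_eq0 => /orP[] /eqP; lra.
Qed.

Lemma hdist_ge0 p q : 0 <= hdist p q.
Proof. by rewrite arcosh_ge0 ?mink_ge1. Qed.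

Lemma cosh_hdist p q : cosh (hdist p q) = - mink (set_val p) (set_val q).
Proof. by rewrite arcoshK ?mink_ge1. Qed.

Lemma hdistpp p : hdist p p = 0.
Proof. by rewrite /hdist minkpp opprK -[X in arcosh X]cosh0 coshK normr0. Qed.

Lemma hdist_lt p q t : 0 <= t ->
  (hdist p q < t) = (- mink (set_val p) (set_val q) < cosh t).
Proof. by move=> t0; rewrite -cosh_hdist ltr_cosh !ger0_norm// hdist_ge0. Qed.

Lemma hdist_le p q t : 0 <= t ->
  (hdist p q <= t) = (- mink (set_val p) (set_val q) <= cosh t).
Proof. by move=> t0; rewrite -cosh_hdist ler_cosh !ger0_norm// hdist_ge0. Qed.

(** The exponential map.  The combination lies on the hyperboloid only when [u]
    is a unit tangent vector at [p]; otherwise the value is [p]. *)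
Definition gpt p u t : hplane R :=
  insubd p (cosh t *: set_val p + sinh t *: u).

(** The velocity of [gpt p u] at time [t]. *)
Definition gdir p u t : 'rV[R]_3 := sinh t *: set_val p + cosh t *: u.

Section Line.
Variables (p : hplane R) (u : 'rV[R]_3).
Hypothesis pu : unit_tangent p u.

Lemma val_gpt t : set_val (gpt p u t) = cosh t *: set_val p + sinh t *: u.
Proof.
case: pu => pu0 uu; apply: etrans (val_insubd _ _) _.
rewrite mem_set//; split.
  rewrite !minkE minkpp pu0 (minkC u) pu0 uu.
  by have := cosh2_sinh2 t; rewrite !expr2; lra.
have := minkpp p; have := coord0_gt0 p.
move: pu0 uu; rewrite /mink !mxE; move: (set_val p) => P.
move: (P 0 0) (P 0 1) (P 0 2) (u 0 0) (u 0 1) (u 0 2) => a b c d e f pu0 uu a0 pp.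
have da : d ^+ 2 < a ^+ 2.
  have : (a * d) ^+ 2 <= (b ^+ 2 + c ^+ 2) * (e ^+ 2 + f ^+ 2).
    have -> : a * d = b * e + c * f by lra.
    by have := sqr_ge0 (b * f - c * e); nra.
  have -> : b ^+ 2 + c ^+ 2 = a ^+ 2 - 1 by lra.
  have -> : e ^+ 2 + f ^+ 2 = d ^+ 2 + 1 by lra.
  by nra.
have := cosh2_sinh2 t; have := cosh_gt0 t; move: (cosh t) (sinh t) => C S C0 CS.
rewrite ltNge; apply/negP => H.
have sqr_le (x y : R) : 0 < x -> x + y <= 0 -> x ^+ 2 <= y ^+ 2 by nra.
have := sqr_le _ _ (mulr_gt0 C0 a0) H.
have : 0 < C ^+ 2 * (a ^+ 2 - d ^+ 2) by rewrite mulr_gt0 ?exprn_gt0 ?subr_gt0.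
by rewrite !exprMn; have := sqr_ge0 d; nra.
Qed.

Lemma geodesic_atE q : geodesic_at p u q <-> exists t, q = gpt p u t.
Proof.
split=> -[t qt]; exists t; last by rewrite qt val_gpt.
by apply: hplane_inj; rewrite val_gpt.
Qed.

Lemma gpt0 : gpt p u 0 = p.
Proof. by apply: hplane_inj; rewrite val_gpt cosh0 sinh0 scale1r scale0r addr0. Qed.

Lemma mink_gpt s t :
  mink (set_val (gpt p u s)) (set_val (gpt p u t)) = - cosh (s - t).
Proof.
case: pu => pu0 uu.
by rewrite !val_gpt !minkE minkpp pu0 (minkC u) pu0 uu coshB; ring.
Qed.

Lemma hdist_gpt s t : hdist (gpt p u s) (gpt p u t) = `|s - t|.
Proof. by rewrite /hdist mink_gpt opprK coshK. Qed.

Lemma unit_tangent_gdir t : unit_tangent (gpt p u t) (gdir p u t).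
Proof.
case: pu => pu0 uu; rewrite /unit_tangent val_gpt /gdir.
rewrite !minkE minkpp pu0 (minkC u) pu0 uu; have := cosh2_sinh2 t.
by rewrite !expr2; split; lra.
Qed.

Lemma unit_tangentN : unit_tangent p (- u).
Proof.
by case: pu => pu0 uu; rewrite -scaleN1r /unit_tangent !minkE pu0 uu; split; lra.
Qed.

Lemma tangent_span v t : mink (set_val p) v = 0 -> mink u v = 0 ->
  mink (set_val (gpt p u t)) v = 0 /\ mink (gdir p u t) v = 0.
Proof.
by move=> pv uv; rewrite val_gpt /gdir !minkE pv uv; split; ring.
Qed.

End Line.

Lemma gptN p u t : unit_tangent p u -> gpt p (- u) t = gpt p u (- t).
Proof.
move=> pu; apply: hplane_inj; rewrite !val_gpt//; last exact: unit_tangentN.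
by rewrite coshN sinhN scalerN scaleNr.
Qed.

Lemma gptD p u s t : unit_tangent p u ->
  gpt (gpt p u s) (gdir p u s) t = gpt p u (s + t).
Proof.
move=> pu; apply: hplane_inj.
rewrite val_gpt; last exact: unit_tangent_gdir.
rewrite !val_gpt// /gdir coshD sinhD.
rewrite !scalerDr !scalerA !scalerDl addrACA (mulrC (cosh s)) (mulrC (sinh s)).
by rewrite [in sinh s * _]mulrC [in cosh s * _]mulrC.
Qed.

Lemma geodesic_at_gdir p u t : unit_tangent p u ->
  geodesic_at (gpt p u t) (gdir p u t) = geodesic_at p u.
Proof.
move=> pu; have pu' := unit_tangent_gdir pu t.
apply/seteqP; split => q.
- move=> /(geodesic_atE pu')[s ->]; apply/(geodesic_atE pu).
  by exists (t + s); rewrite gptD.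
- move=> /(geodesic_atE pu)[s ->]; apply/(geodesic_atE pu').
  by exists (s - t); rewrite gptD// subrKC.
Qed.

(** The witness is the Minkowski cross product of [p] and [u]; its square norm
    is minus the Gram determinant of [p] and [u]. *)
Lemma exists_normal p u : unit_tangent p u ->
  exists v, [/\ mink (set_val p) v = 0, mink u v = 0 & mink v v = 1].
Proof.
move=> [pu uu]; have pp := minkpp p; move: (set_val p) pu pp => P pu pp.
exists (\row_j (nth 0 [:: - (P 0 1 * u 0 2 - P 0 2 * u 0 1);
  P 0 2 * u 0 0 - P 0 0 * u 0 2; P 0 0 * u 0 1 - P 0 1 * u 0 0] j)).
rewrite /mink !mxE /=.
move: pu uu pp; rewrite /mink.
move: (P 0 0) (P 0 1) (P 0 2) (u 0 0) (u 0 1) (u 0 2) => a b c d e f pu uu pp.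
split; [by ring|by ring|].
transitivity (- ((b * b + c * c - a * a) * (e * e + f * f - d * d)
  - (b * e + c * f - a * d) ^+ 2)); first by ring.
by rewrite pu uu pp; ring.
Qed.

Lemma exists_unit_tangent p : exists u, unit_tangent p u.
Proof.
have pp := minkpp p.
(* The second basis vector, projected to the tangent plane and normalized. *)
pose e : 'rV[R]_3 := \row_j (j == 1 :> nat)%:R.
pose x := set_val p 0 1.
have me : mink (set_val p) e = x by rewrite /mink !mxE/= /x; ring.
have ee : mink e e = 1 by rewrite /mink !mxE/=; ring.
pose k := Num.sqrt (1 + x ^+ 2).
have k0 : 0 < 1 + x ^+ 2 by have := sqr_ge0 x; lra.
have kk : k ^+ 2 = 1 + x ^+ 2 by rewrite sqr_sqrtr// ltW.
have k1 : 0 < k by rewrite sqrtr_gt0.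
exists (k^-1 *: (e + x *: set_val p)); split.
  by rewrite !minkE me pp; ring.
rewrite !minkE me pp (minkC e) me ee.
transitivity ((k ^+ 2)^-1 * (1 + x ^+ 2)).
  by rewrite expr2 invfM; ring.
by rewrite kk mulVf// gt_eqF.
Qed.

Lemma exists_gpt p q : exists2 u, unit_tangent p u & q = gpt p u (hdist p q).
Proof.
have [->|/eqP pq] := eqVneq q p.
  have [u pu] := exists_unit_tangent p; exists u => //.
  by rewrite hdistpp gpt0.
have d0 : 0 < hdist p q.
  rewrite lt_neqAle hdist_ge0 andbT eq_sym; apply/eqP => d0.
  apply: pq; apply/esym/mink_eqN1.
  by rewrite -[LHS]opprK -cosh_hdist d0 cosh0.
have S0 := sinh_gt0 d0; have CS := cosh2_sinh2 (hdist p q).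
have mpq := cosh_hdist p q.
have eu : unit_tangent p ((sinh (hdist p q))^-1 *:
    (set_val q - cosh (hdist p q) *: set_val p)).
  rewrite /unit_tangent -scaleNr !minkE !minkpp (minkC (set_val q)).
  have -> : mink (set_val p) (set_val q) = - cosh (hdist p q).
    by rewrite mpq opprK.
  split; first by ring.
  move: (cosh _) (sinh _) S0 CS => C S S0 CS.
  transitivity ((S ^+ 2)^-1 * (C ^+ 2 - 1)).
    by rewrite expr2 invfM; ring.
  have -> : C ^+ 2 - 1 = S ^+ 2 by lra.
  by rewrite mulVf// expf_eq0/= gt_eqF.
eexists; first exact: eu.
apply: hplane_inj; rewrite val_gpt// scalerA divff ?gt_eqF// scale1r.
by rewrite subrKC.
Qed.

Lemma hdist_eq0 p q : hdist p q = 0 -> p = q.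
Proof. by have [u pu {2}->] := exists_gpt p q => ->; rewrite gpt0. Qed.

Lemma hplane_continuous (T : topologicalType) (f : T -> hplane R) :
  continuous (fun x => set_val (f x)) -> continuous f.
Proof.
move=> cf; exact: (@continuous_comp_initial _ _ _ set_val f cf).
Qed.

Lemma continuous_set_val : continuous (fun p : hplane R => set_val p).
Proof. exact: initial_continuous. Qed.

Lemma continuous_gpt p u : unit_tangent p u -> continuous (gpt p u).
Proof.
move=> pu; apply: hplane_continuous.
rewrite (_ : (fun _ => _) = fun t => cosh t *: set_val p + sinh t *: u); last first.
  by apply/funext => t; rewrite val_gpt.
by move=> t; apply: cvgD; apply: cvgZr_tmp; [exact: continuous_cosh|exact: continuous_sinh].
Qed.

Lemma continuous_mink (T : topologicalType) (f g : T -> 'rV[R]_3) :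
  continuous f -> continuous g -> continuous (fun x => mink (f x) (g x)).
Proof.
move=> cf cg.
have c1 i : continuous (fun x => f x 0 i * g x 0 i).
  move=> x; apply: cvgM.
  - by apply: (@continuous_comp _ _ _ f (fun y : 'rV[R]_3 => y 0 i));
      [exact: cf|exact: coord_continuous].
  - by apply: (@continuous_comp _ _ _ g (fun y : 'rV[R]_3 => y 0 i));
      [exact: cg|exact: coord_continuous].
by rewrite /mink => x; apply: cvgB; [apply: cvgD|]; exact: c1.
Qed.

End Points.

(** * Segments and midpoints *)

Section Incidence.
Context {R : realType}.
Implicit Types (p q : hplane R) (u v : 'rV[R]_3) (s t : R).

Lemma gpt_inj p u : unit_tangent p u -> injective (gpt p u).
Proof.
move=> pu s t /(congr1 (hdist (gpt p u s))); rewrite !hdist_gpt// subrr normr0.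
by move=> /esym/normr0_eq0 /eqP; rewrite subr_eq0 => /eqP.
Qed.

Lemma segment_gpt p u a b t : unit_tangent p u ->
  segment (gpt p u a) (gpt p u b) (gpt p u t) <-> a <= t <= b \/ b <= t <= a.
Proof.
move=> pu; rewrite /segment /= !hdist_gpt//; split.
  by case: (ger0P (a - t)); case: (ger0P (t - b)); case: (ger0P (a - b)) => *;
    (try (left; apply/andP; split; lra)); (try (right; apply/andP; split; lra)); lra.
by move=> [] /andP[? ?];
  case: (ger0P (a - t)); case: (ger0P (t - b)); case: (ger0P (a - b)) => *; lra.
Qed.

Lemma segment_l p q : segment p q p.
Proof. by rewrite /segment/= hdistpp add0r. Qed.

Lemma segment_r p q : segment p q q.
Proof. by rewrite /segment/= hdistpp addr0. Qed.

Lemma hdist_gt0 p q : p <> q -> 0 < hdist p q.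
Proof.
move=> pq; rewrite lt_neqAle hdist_ge0 andbT; apply/eqP => /esym.
by move=> /hdist_eq0.
Qed.

(** The midpoint of a segment.  The choice of a direction is harmless when
    [p = q], and [val_hmid] removes it altogether. *)
Definition hmid p q : hplane R :=
  gpt p (s2val (cid2 (exists_gpt p q))) (hdist p q / 2).

Lemma half_gpt p u t : unit_tangent p u ->
  set_val (gpt p u (t / 2)) = (Num.sqrt (2 + 2 * cosh t))^-1 *:
    (set_val p + set_val (gpt p u t)).
Proof.
move=> pu; rewrite !val_gpt//; set h := t / 2.
rewrite (_ : t = h + h); last by rewrite /h; field.
rewrite coshD sinhD; have := cosh2_sinh2 h; have := cosh_gt0 h => C0 CS.
have -> : Num.sqrt (2 + 2 * (cosh h * cosh h + sinh h * sinh h)) = 2 * cosh h.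
  rewrite (_ : 2 + _ = (2 * cosh h) ^+ 2); last by lra.
  by rewrite sqrtr_sqr ger0_norm// mulr_ge0// ltW.
rewrite addrA -{2}[set_val p]scale1r -scalerDl scalerDr !scalerA.
have c0 : 2 * cosh h != 0 by rewrite mulf_neq0// gt_eqF.
congr (_ *: _ + _ *: _).
  by rewrite (_ : 1 + _ = 2 * cosh h * cosh h) ?mulKf//; lra.
by rewrite (_ : _ + _ = 2 * cosh h * sinh h) ?mulKf//; ring.
Qed.

(** This formula, symmetric and free of choices, makes the midpoint visibly
    continuous. *)
Lemma val_hmid p q : set_val (hmid p q) =
  (Num.sqrt (2 - 2 * mink (set_val p) (set_val q)))^-1 *:
    (set_val p + set_val q).
Proof.
rewrite /hmid; case: cid2 => /= u pu qE.
by rewrite half_gpt// -qE cosh_hdist mulrN.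
Qed.

Lemma hmid_gpt p u t : unit_tangent p u -> hmid p (gpt p u t) = gpt p u (t / 2).
Proof.
move=> pu; apply: hplane_inj; rewrite val_hmid half_gpt//.
by rewrite -{1}(gpt0 pu) mink_gpt// sub0r coshN mulrN opprK.
Qed.

Lemma continuous_mink_l (a : 'rV[R]_3) :
  continuous (fun p : hplane R => mink (set_val p) a).
Proof.
apply: (@continuous_mink R (hplane R) (fun p => set_val p) (fun=> a)).
  exact: continuous_set_val.
exact: cst_continuous.
Qed.

Lemma continuous_hmid q : continuous (hmid^~ q).
Proof.
have cH (T : topologicalType) (f : T -> 'rV[R]_3) a : continuous f ->
    (forall x, mink (f x) a <= -1) ->
    continuous (fun x => (Num.sqrt (2 - 2 * mink (f x) a))^-1 *: (f x + a)).
  move=> cf fa x; apply: cvgZ; last by apply: cvgD; [exact: cf|exact: cvg_cst].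
  apply: cvgV; first by rewrite gt_eqF// sqrtr_gt0; have := fa x; lra.
  apply: (@continuous_comp _ _ _ (fun x => 2 - 2 * mink (f x) a) Num.sqrt);
    last exact: sqrt_continuous.
  apply: cvgB; first exact: cvg_cst.
  apply: cvgM; first exact: cvg_cst.
  by apply: continuous_mink => // y; exact: cvg_cst.
apply: hplane_continuous.
rewrite (_ : (fun _ => _) = fun p =>
   (Num.sqrt (2 - 2 * mink (set_val p) (set_val q)))^-1 *:
    (set_val p + set_val q)); last by apply/funext => p; rewrite val_hmid.
apply: cH; first exact: continuous_set_val.
by move=> p; have := mink_ge1 p q; lra.
Qed.

End Incidence.

(** * Convexity *)

Section Convex.
Context {R : realType} (K : set (hplane R)) (D : R).
Hypothesis Kclosed : closed K.
Hypothesis Kbounded : forall p q, K p -> K q -> hdist p q <= D.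
Hypothesis Kconvex : hconvex K.
Implicit Types (p q : hplane R) (u v : 'rV[R]_3) (s t : R).

Lemma boundaryP p : boundary K p <-> K p /\ ~ K° p.
Proof. by rewrite /boundary -(closure_id K).1. Qed.

(** The segment is connected, and on it the preimages of [K] and of its interior
    would coincide if it met no boundary point. *)
Lemma crossing_lr p u a b : unit_tangent p u -> a <= b ->
  K° (gpt p u a) -> ~ K° (gpt p u b) ->
  exists2 t, a < t <= b & boundary K (gpt p u t).
Proof.
move=> pu ab Ka Kb; apply: contrapT => H.
have cg := continuous_gpt pu.
have aab : `[a, b]%classic a by rewrite /= in_itv/= lexx.
have bab : `[a, b]%classic b by rewrite /= in_itv/= lexx andbT.
suff /seteqP[_ /(_ b bab)[]//] :
  `[a, b]%classic `&` (gpt p u @^-1` K°) = `[a, b]%classic.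
apply: (@segment_connected R a b).
- by exists a.
- exists (gpt p u @^-1` K°) => //; apply: open_comp; last exact: open_interior.
  by move=> x _; exact: cg.
- exists (gpt p u @^-1` K); first by apply: closed_comp => // x _; exact: cg.
  apply/seteqP; split => t /= [tab Kt]; split => //; first exact: interior_subset.
  apply: contrapT => Kt'; apply: H; exists t; last exact/boundaryP.
  move: tab; rewrite in_itv/= => /andP[at_ ->]; rewrite andbT lt_neqAle at_ andbT.
  by apply/eqP => ta; apply: Kt'; rewrite -ta.
Qed.

(** A geodesic is unbounded, so it cannot stay in [K]. *)
Lemma exit_right p u a : unit_tangent p u -> K° (gpt p u a) ->
  exists2 t, a < t & boundary K (gpt p u t).
Proof.
move=> pu Ka; have K1 := interior_subset Ka.
have D0 := Kbounded K1 K1; rewrite hdistpp in D0.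
have [//||//||t /andP[at_ _] Kt] := @crossing_lr p u a (a + D + 1).
- by lra.
- move=> /interior_subset K2; have := Kbounded K1 K2.
  by rewrite hdist_gpt// ler0_norm; lra.
- by exists t.
Qed.

Lemma exit_left p u a : unit_tangent p u -> K° (gpt p u a) ->
  exists2 t, t < a & boundary K (gpt p u t).
Proof.
move=> pu Ka; have [||t at_ Kt] := @exit_right p (- u) (- a).
- exact: unit_tangentN.
- by rewrite gptN// opprK.
- by exists (- t); [lra|rewrite -gptN].
Qed.

(** Three boundary points exclude the first alternative in [hconvex], and the
    arc provided by the second one contains everything between two of its
    points. *)
Lemma hconvex_boundary3 p u t1 t2 t3 s : unit_tangent p u ->
  t1 < t2 -> t2 < t3 -> t1 <= s <= t3 ->
  boundary K (gpt p u t1) -> boundary K (gpt p u t2) ->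
  boundary K (gpt p u t3) -> boundary K (gpt p u s).
Proof.
move=> pu t12 t23 /andP[t1s st3] K1 K2 K3.
have G t : geodesic_at p u (gpt p u t) by apply/geodesic_atE => //; exists t.
have [|H|[a [b [_ H]]]] := Kconvex (G := geodesic_at p u).
- by exists p, u.
- by have [] := H _ _ _ (conj (G t1) K1) (conj (G t2) K2) (conj (G t3) K3) =>
    /(gpt_inj pu); lra.
have [a' ea] : exists a', a = gpt p u a'.
  by apply/(geodesic_atE pu); have := segment_l a b; rewrite -H => -[].
have [b' eb] : exists b', b = gpt p u b'.
  by apply/(geodesic_atE pu); have := segment_r a b; rewrite -H => -[].
have M t : boundary K (gpt p u t) <->
    segment (gpt p u a') (gpt p u b') (gpt p u t).
  by rewrite -ea -eb -H; split=> [|[]//]; split.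
move/M/(segment_gpt _ _ _ pu) : K1; move/M/(segment_gpt _ _ _ pu) : K3 => K3 K1.
apply/M/(segment_gpt _ _ _ pu); clear -K1 K3 t12 t23 t1s st3.
by case: K1 => /andP[? ?]; case: K3 => /andP[? ?]; [left|left|right|right];
  apply/andP; split; lra.
Qed.

(** A point of the geodesic that were not interior would yield a boundary point
    between [a] and [c].  Together with the boundary points where the geodesic
    leaves [K] on both sides this makes three, with the interior point at [a]
    between the outer two. *)
Lemma interior_between p u a b c : unit_tangent p u ->
  K° (gpt p u a) -> K (gpt p u b) -> a < c -> c < b -> K° (gpt p u c).
Proof.
move=> pu Ka Kb ac cb; apply: contrapT => Kc.
have [t2 /andP[at2 t2c] K2] := crossing_lr pu (ltW ac) Ka Kc.
have [t1 t1a K1] := exit_left pu Ka.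
have [t3 bt3 K3] : exists2 t3, b <= t3 & boundary K (gpt p u t3).
  have [/(exit_right pu)[t bt Kt]|Kb'] := pselect (K° (gpt p u b)).
    by exists t => //; exact: ltW.
  by exists b => //; exact/boundaryP.
have := @hconvex_boundary3 p u t1 t2 t3 a pu.
by case/(_ _ _ _ K1 K2 K3)/boundaryP => //; lra.
Qed.

Lemma interior_hmid p q : p <> q -> K° p -> K q -> K° (hmid p q).
Proof.
move=> pq Kp Kq; have d0 := hdist_gt0 pq.
rewrite /hmid; case: cid2 => /= u pu qE.
apply: (@interior_between p u 0 (hdist p q)) => //; [|by rewrite -qE|lra|lra].
by rewrite gpt0.
Qed.

End Convex.

(** * Supporting geodesics and width *)

Section Normal.
Context {R : realType}.
Implicit Types (p q : hplane R) (u v : 'rV[R]_3) (s t : R) (K : set (hplane R)).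

(** [v] is a unit vector normal to the plane of the geodesic, hence tangent to
    the hyperboloid at every point of the geodesic. *)
Definition unit_normal p u v : Prop :=
  [/\ mink (set_val p) v = 0, mink u v = 0 & mink v v = 1].

Lemma unit_normalN p u v : unit_normal p u v -> unit_normal p (- u) v.
Proof. by case=> pv uv vv; split; rewrite // -scaleN1r minkZl uv mulr0. Qed.

Section Perpendicular.
Variables (p : hplane R) (u v : 'rV[R]_3).
Hypotheses (pu : unit_tangent p u) (nv : unit_normal p u v).

Lemma unit_tangent_normal t : unit_tangent (gpt p u t) v.
Proof. by case: nv => pv uv vv; case: (tangent_span pu t pv uv). Qed.

Lemma mink_perp a b s :
  mink (set_val (gpt p u a)) (set_val (gpt (gpt p u b) v s)) =
  - (cosh (a - b) * cosh s).
Proof.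
have [av _] := unit_tangent_normal a.
by rewrite (val_gpt (unit_tangent_normal b)) !minkE av mink_gpt//; ring.
Qed.

Lemma perpendicular_normal t :
  perpendicular (geodesic_at p u) (geodesic_at (gpt p u t) v).
Proof.
exists (gpt p u t), (gdir p u t), v; split => //.
- exact: unit_tangent_gdir.
- exact: unit_tangent_normal.
- by case: nv => pv uv vv; case: (tangent_span pu t pv uv).
- by rewrite geodesic_at_gdir.
Qed.

Lemma perp_neq a b : a != b ->
  geodesic_at (gpt p u a) v <> geodesic_at (gpt p u b) v.
Proof.
move=> ab E; have va := unit_tangent_normal a.
have : geodesic_at (gpt p u b) v (gpt p u b).
  by apply/(geodesic_atE (unit_tangent_normal b)); exists 0; rewrite gpt0//; exact: unit_tangent_normal.
rewrite -E => /(geodesic_atE va)[r rE].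
have := mink_perp b a r; rewrite -rE minkpp => /oppr_inj H.
have : cosh 0 < cosh (b - a) by rewrite ltr_cosh normr0 normr_gt0 subr_eq0 eq_sym.
by rewrite cosh0; have := cosh_ge1 r; nra.
Qed.

Lemma geodesic_perp t : geodesic (geodesic_at (gpt p u t) v).
Proof. by exists (gpt p u t), v; split => //; exact: unit_tangent_normal. Qed.

Lemma geodesic_at_base q w : unit_tangent q w -> geodesic_at q w q.
Proof. by move=> qw; apply/(geodesic_atE qw); exists 0; rewrite gpt0. Qed.

Lemma width_between K s t : s != t ->
  supporting K (geodesic_at (gpt p u s) v) ->
  supporting K (geodesic_at (gpt p u t) v) ->
  is_width K (gpt p u s) `|s - t|.
Proof.
move=> st Ks Kt.
exists (geodesic_at (gpt p u s) v), (geodesic_at p u),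
  (geodesic_at (gpt p u t) v), (gpt p u t); split => //.
- by split => //; apply: geodesic_at_base; exact: unit_tangent_normal.
- by split; [apply/(geodesic_atE pu); exists s|exact: perpendicular_normal].
- split => //; last exact: perpendicular_normal.
  by apply: perp_neq; rewrite eq_sym.
- split; first by apply/(geodesic_atE pu); exists t.
  by apply: geodesic_at_base; exact: unit_tangent_normal.
- exact: hdist_gpt.
Qed.

(** All other points of the perpendicular lie farther from [gpt p u a] than
    its foot [gpt p u b] does: in a right triangle the hyperbolic cosine of the
    hypotenuse is the product of those of the legs. *)
Lemma supporting_farthest K (d a b : R) : closed K ->
  (forall x y, K x -> K y -> hdist x y <= d) -> K (gpt p u b) -> a != b ->
  (forall q, K q -> hdist (gpt p u a) q <= `|a - b|) ->
  supporting K (geodesic_at (gpt p u b) v) /\ boundary K (gpt p u b).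
Proof.
move=> Kcl Kd Kb ab Kfar.
have bb : boundary K (gpt p u b).
  apply/boundaryP => //; split => // Ib; move: ab; rewrite neq_lt => /orP[ab|ba].
  - have [t bt /(boundaryP Kcl)[/Kfar + _]] := exit_right Kcl Kd pu Ib.
    by rewrite hdist_gpt// !ltr0_norm; lra.
  - have [t tb /(boundaryP Kcl)[/Kfar + _]] := exit_left Kcl Kd pu Ib.
    by rewrite hdist_gpt// !gtr0_norm; lra.
have vb := unit_tangent_normal b.
split => //; split; first exact: geodesic_perp.
left; exists (gpt p u b); apply/seteqP; split => [q [/(geodesic_atE vb)[s ->]]|q ->].
- move=> /(boundaryP Kcl)[/Kfar + _].
  rewrite hdist_le// mink_perp opprK cosh_abs => H.
  have [->|s0] := eqVneq s 0; first by rewrite gpt0.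
  have : cosh 0 < cosh s by rewrite ltr_cosh normr0 normr_gt0.
  by rewrite cosh0; have := cosh_gt0 (a - b); nra.
- by split=> //; exact: geodesic_at_base.
Qed.

(** The ball around [p] of radius [m] lies in [K] and touches the boundary at
    [z = gpt p u m].  If its tangent geodesic at [z] met the interior of [K],
    then so would, on the same side of [z], a geodesic through [z] that is
    tilted slightly outwards.  Beyond [z] that geodesic enters the ball, so
    that [z] would lie between two interior points. *)
Lemma tangent_misses_interior K (d m : R) s : closed K ->
  (forall x y, K x -> K y -> hdist x y <= d) -> hconvex K -> 0 < m ->
  (forall q, hdist p q < m -> K° q) -> boundary K (gpt p u m) ->
  ~ K° (gpt (gpt p u m) v s).
Proof.
move=> Kcl Kd Kconv m0 Kball /(boundaryP Kcl)[Kz nKz].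
set z := gpt p u m in Kz nKz *; have vz : unit_tangent z v := unit_tangent_normal m.
set q := gpt z v s => Kq.
have zw := unit_tangent_gdir pu m; set w := gdir p u m in zw; rewrite -/z in zw.
have wv : mink w v = 0 by case: nv => pv uv vv; case: (tangent_span pu m pv uv).
have pw : mink (set_val p) w = - sinh m.
  by case: pu => pu0 uu; rewrite /w /gdir !minkE minkpp pu0; ring.
clearbody w.
have qw : unit_tangent q w.
  case: zw => zw ww; split => //.
  by rewrite (val_gpt vz) !minkE zw (minkC v) wv; ring.
(* Tilting: [q'] is [q] moved away from [p] by a small amount. *)
have [e e0 Kq'] : exists2 e : R, 0 < e & K° (gpt q w e).
  have : nbhs (gpt q w 0) K° by rewrite gpt0//; apply: open_nbhs_nbhs; split=> //; exact: open_interior.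
  move=> /(continuous_gpt qw) /nbhs_ballP[e /= e0 He].
  exists (e / 2); first by rewrite divr_gt0.
  apply: He; rewrite /ball/= sub0r normrN gtr0_norm; last by rewrite divr_gt0.
  by lra.
move: Kq'; set q' := gpt q w e => Kq'.
have zq : z <> q' by move=> E; apply: nKz; rewrite E.
have [u' zu' q'E] := exists_gpt z q'.
have d0 := hdist_gt0 zq; set h := hdist z q' in d0 q'E.
have pz : mink (set_val p) (set_val z) = - cosh m.
  by rewrite -{1}(gpt0 pu) mink_gpt// sub0r coshN.
have pq : mink (set_val p) (set_val q) = - (cosh m * cosh s).
  by rewrite -{1}(gpt0 pu) mink_perp sub0r coshN.
have zqs : mink (set_val z) (set_val q) = - cosh s.
  by rewrite mink_perp subrr cosh0 mul1r.
have pq' : mink (set_val p) (set_val q') =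
    - (cosh e * (cosh m * cosh s) + sinh e * sinh m).
  by rewrite (val_gpt qw) !minkE pq pw; ring.
have zq' : cosh h = cosh e * cosh s.
  by rewrite cosh_hdist (val_gpt qw) !minkE zqs (zw.1); ring.
(* The derivative at [z], towards [q'], of the hyperbolic cosine of the
   distance from [p]. *)
pose k := - mink (set_val p) u'.
have kE : sinh h * k = sinh e * sinh m.
  move: pq'; rewrite {1}q'E (val_gpt zu') !minkE pz zq' /k => H.
  by lra.
have k0 : 0 < k.
  have := sinh_gt0 d0; have := mulr_gt0 (sinh_gt0 e0) (sinh_gt0 m0).
  by rewrite -kE; nra.
have C0 := cosh_gt0 m.
(* A time [t] with [(cosh t - 1) * cosh m < sinh t * k] is wanted.  With
   [E = expR t] this is [(E - 1) * cosh m < (E + 1) * k]. *)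
pose E := 1 + k / cosh m.
have E1 : 1 < E by rewrite /E ltrDl divr_gt0.
have E0 : 0 < E by lra.
have kC : k = (E - 1) * cosh m by rewrite /E addrAC subrr add0r divfK// gt_eqF.
pose t := ln E; have t0 : 0 < t by rewrite /t ln_gt0.
have eE : expR t = E by rewrite /t lnK.
have Kc : K° (gpt z u' (- t)).
  apply: Kball; rewrite hdist_lt; last exact: ltW.
  rewrite (val_gpt zu') !minkE pz coshN sinhN.
  rewrite (_ : - _ = cosh t * cosh m - sinh t * k); last by rewrite /k; ring.
  rewrite kC /cosh /sinh expRN eE -/(cosh m).
  rewrite -subr_gt0 (_ : _ - _ = cosh m * ((E - 1) ^+ 2 / 2)).
    by rewrite mulr_gt0// divr_gt0// exprn_gt0// subr_gt0.
  by field; rewrite gt_eqF.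
apply: nKz; rewrite -(gpt0 zu').
apply: (interior_between Kcl Kd Kconv zu' Kc) (_ : K (gpt z u' h)) _ _ => //; last by lra.
by rewrite -q'E; exact: interior_subset.
Qed.

(** By [hconvex] it only has to be excluded that the tangent geodesic meets the
    boundary in exactly two points, the point of contact [z] and some [r].
    Their midpoint is a limit of midpoints of [r] and points of the ball, which
    are interior to [K]; so it belongs to [K], hence to the boundary because
    the tangent geodesic misses the interior, and is a third point. *)
Lemma supporting_nearest K (d m : R) : closed K ->
  (forall x y, K x -> K y -> hdist x y <= d) -> hconvex K -> 0 < m ->
  (forall q, hdist p q < m -> K° q) -> boundary K (gpt p u m) ->
  supporting K (geodesic_at (gpt p u m) v).
Proof.
move=> Kcl Kd Kconv m0 Kball bz.
have out s := tangent_misses_interior (s := s) Kcl Kd Kconv m0 Kball bz.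
have vz := unit_tangent_normal m; have Gz := geodesic_at_base vz.
split; first exact: geodesic_perp.
have [H|] := Kconv _ (geodesic_perp m); [left|by right].
exists (gpt p u m); apply/seteqP; split => [r [Gr br]|r -> //].
apply: contrapT => rz; have /(geodesic_atE vz)[s rE] := Gr.
have [Kr nKr] := (boundaryP Kcl r).1 br.
have s0 : s != 0 by apply/eqP => s0; apply: rz; rewrite rE s0 gpt0.
have ME := hmid_gpt s vz; rewrite -rE in ME.
have KM : K (hmid (gpt p u m) r).
  apply: contrapT => nKM.
  have : nbhs (hmid (gpt p u m) r) (~` K).
    by apply: open_nbhs_nbhs; split => //; exact: closed_openC.
  move=> /(@continuous_hmid R r _) /(continuous_gpt pu) /nbhs_ballP[e /= e0 He].
  (* A parameter so close to [m] that the midpoint stays outside [K], and in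
     [[0, m[] so that the point lies in the ball. *)
  pose t := m - Num.min (e / 2) m.
  have mn : 0 < Num.min (e / 2) m by rewrite lt_min m0 divr_gt0.
  have mn1 : Num.min (e / 2) m <= e / 2 by rewrite ge_min lexx.
  have mn2 : Num.min (e / 2) m <= m by rewrite ge_min lexx orbT.
  have Kt : K° (gpt p u t).
    by apply: Kball; rewrite -{1}(gpt0 pu) hdist_gpt// sub0r normrN ger0_norm /t; lra.
  apply: (He t); first by rewrite /ball/= /t opprB addrCA subrr addr0 gtr0_norm//; lra.
  apply: interior_subset; apply: (interior_hmid Kcl Kd Kconv) => //.
  by move=> E; apply: nKr; rewrite -E.
have bM : boundary K (hmid (gpt p u m) r).
  by apply/(boundaryP Kcl); split => //; rewrite ME; exact: out.
have GM : geodesic_at (gpt p u m) v (hmid (gpt p u m) r).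
  by apply/(geodesic_atE vz); exists (s / 2).
have [|E|E] := H _ _ _ (conj Gz bz) (conj GM bM) (conj Gr br).
- rewrite ME -{1}(gpt0 vz) => /(gpt_inj vz) E.
  by move/eqP: s0; lra.
- exact: rz.
- by move: E; rewrite ME {1}rE => /(gpt_inj vz) E; move/eqP: s0; lra.
Qed.

End Perpendicular.

End Normal.

(** * Diameters and farthest points *)

Section Extremal.
Context {R : realType} (K : set (hplane R)).
Implicit Types (p q : hplane R) (u v : 'rV[R]_3) (s t l : R).

Lemma exists_diameter : compact K -> K !=set0 ->
  exists p q, [/\ K p, K q & forall x y, K x -> K y -> hdist x y <= hdist p q].
Proof.
move=> Kc [k Kk].
pose f (x : hplane R * hplane R) := mink (set_val x.1) (set_val x.2).
have cf : continuous f.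
  by apply: continuous_mink => x; (apply: continuous_comp; last exact: continuous_set_val);
    [exact: cvg_fst|exact: cvg_snd].
have [|||[p q]] := @compact_EVT_min _ _ f (K `*` K).
- by exists (k, k).
- exact: compact_setX.
- exact: continuous_subspaceT.
rewrite inE => -[/= Kp Kq] H; exists p, q; split=> // x y Kx Ky.
rewrite hdist_le ?hdist_ge0// cosh_hdist lerN2.
by apply: (H (x, y)); rewrite inE.
Qed.

Lemma exists_farthest p : compact K -> K !=set0 ->
  exists2 q, K q & forall x, K x -> hdist p x <= hdist p q.
Proof.
move=> Kc K0.
have [//|//||q] := @compact_EVT_min _ _ (fun x => mink (set_val x) (set_val p)) K.
  by apply: continuous_subspaceT; exact: continuous_mink_l.
rewrite inE => Kq H; exists q => // x Kx.
rewrite hdist_le ?hdist_ge0// cosh_hdist lerN2 !(minkC (set_val p)).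
by apply: H; rewrite inE.
Qed.

Lemma constant_widthE d l p :
  constant_width K d -> boundary K p -> is_width K p l -> l = d.
Proof. by move=> Kw Bp; have /seteqP[H _] := Kw p Bp; exact: H. Qed.

(** Each end of a diameter is a point of [K] farthest from the other end, so
    the perpendiculars at both ends are supporting geodesics. *)
Lemma diameter_width d p q : closed K -> K p -> K q -> p <> q ->
  (forall x y, K x -> K y -> hdist x y <= hdist p q) ->
  constant_width K d -> hdist p q = d.
Proof.
move=> Kcl Kp Kq pq Kd Kw; have D0 := hdist_gt0 pq.
have [u pu qE] := exists_gpt p q; have [v nv] := exists_normal pu.
set D := hdist p q in D0 qE Kd *.
have [||x Kx|Sp Bp] := supporting_farthest pu nv Kcl Kd (a := D) (b := 0).
- by rewrite gpt0.
- by rewrite gt_eqF.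
- by rewrite subr0 gtr0_norm// -qE; exact: Kd.
have [||x Kx|Sq _] := supporting_farthest pu nv Kcl Kd (a := 0) (b := D).
- by rewrite -qE.
- by rewrite lt_eqF.
- by rewrite sub0r normrN gtr0_norm// gpt0//; exact: Kd.
have D1 : 0 != D by rewrite lt_eqF.
have := width_between pu nv D1 Sp Sq; rewrite sub0r normrN gtr0_norm//.
exact: constant_widthE Kw Bp.
Qed.

End Extremal.

(** * Chords of equal length through a point *)

Section Equichordal.
Context {R : realType} (K : set (hplane R)) (O : hplane R) (d l : R).
Hypothesis Kclosed : closed K.
Hypothesis Kbounded : forall p q, K p -> K q -> hdist p q <= d.
Hypothesis Kconvex : hconvex K.
Hypothesis KO : K° O.
Hypothesis Ksections : forall G : set (hplane R),
  geodesic G -> G O -> segment_of_length (K `&` G) l.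
Implicit Types (p q : hplane R) (u v : 'rV[R]_3) (s t : R).

(** The arc length parameters of the two ends of a chord through [O].  By
    convexity and because [O] is an interior point, the ends are the only
    boundary points on the chord. *)
Lemma chord u : unit_tangent O u -> exists a b : R,
  [/\ a < 0, 0 < b, b - a = l, (forall t, K (gpt O u t) <-> a <= t <= b) &
    forall t, boundary K (gpt O u t) <-> t = a \/ t = b].
Proof.
move=> Ou; have IO : K° (gpt O u 0) by rewrite gpt0.
have [|x [y [H dxy]]] := Ksections (ex_intro _ O (ex_intro _ u (conj Ou erefl))).
  exact: geodesic_at_base.
have [x' ex] : exists x', x = gpt O u x'.
  by apply/(geodesic_atE Ou); have := segment_l x y; rewrite -H => -[].
have [y' ey] : exists y', y = gpt O u y'.
  by apply/(geodesic_atE Ou); have := segment_r x y; rewrite -H => -[].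
have [a [b [ab bal Kab]]] : exists a b : R, [/\ a <= b, b - a = l &
    forall t, K (gpt O u t) <-> a <= t <= b].
  have M t : K (gpt O u t) <-> segment (gpt O u x') (gpt O u y') (gpt O u t).
    rewrite -ex -ey -H; split=> [?|[]//]; split => //.
    by apply/(geodesic_atE Ou); exists t.
  move: dxy; rewrite ex ey hdist_gpt//; have [xy|yx] := leP x' y' => dxy.
  - exists x', y'; split => // [|t]; first by move: dxy; rewrite ler0_norm; lra.
    split => [/M/(segment_gpt _ _ _ Ou)[//|/andP[? ?]]|?]; first by apply/andP; split; lra.
    by apply/M/(segment_gpt _ _ _ Ou); left.
  - exists y', x'; split => [||t]; [lra|by move: dxy; rewrite ger0_norm; lra|].
    split => [/M/(segment_gpt _ _ _ Ou)[/andP[? ?]|//]|?]; first by apply/andP; split; lra.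
    by apply/M/(segment_gpt _ _ _ Ou); right.
have a0 : a < 0.
  have [t t0 /(boundaryP Kclosed)[/Kab/andP[at_ _] _]] := exit_left Kclosed Kbounded Ou IO.
  exact: le_lt_trans at_ t0.
have b0 : 0 < b.
  have [t t0 /(boundaryP Kclosed)[/Kab/andP[_ tb] _]] := exit_right Kclosed Kbounded Ou IO.
  exact: lt_le_trans t0 tb.
exists a, b; split => // t; split.
- move=> /(boundaryP Kclosed)[/Kab/andP[at_ tb] It].
  apply: contrapT => /not_orP[/eqP ta /eqP tb']; apply: It.
  have [t0|t0|->//] := ltgtP t 0.
  + have ON := unit_tangentN Ou.
    rewrite -[t]opprK -gptN//.
    apply: (interior_between Kclosed Kbounded Kconvex ON (a := 0) (b := - a)).
    * by rewrite gpt0.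
    * by rewrite gptN// opprK; apply/Kab; rewrite lexx ltW// (lt_trans a0).
    * lra.
    * by rewrite ltrN2 lt_neqAle eq_sym ta.
  + apply: (interior_between Kclosed Kbounded Kconvex Ou (a := 0) (b := b)) => //.
    * by apply/Kab; rewrite lexx andbT ltW// (lt_trans a0).
    * by rewrite lt_neqAle tb'.
- case=> ->; apply/(boundaryP Kclosed); split; try by apply/Kab; rewrite lexx ?andbT ltW// (lt_trans a0).
  + move=> /(exit_left Kclosed Kbounded Ou)[s sa /(boundaryP Kclosed)[/Kab + _]].
    by rewrite leNgt sa.
  + move=> /(exit_right Kclosed Kbounded Ou)[s sa /(boundaryP Kclosed)[/Kab + _]].
    by rewrite [s <= b]leNgt sa andbF.
Qed.

Lemma hdist_O u t : unit_tangent O u -> hdist O (gpt O u t) = `|t|.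
Proof. by move=> Ou; rewrite -{1}(gpt0 Ou) hdist_gpt// sub0r normrN. Qed.

(** Let [x] be a point of [K] farthest from [O].  Since all chords have length
    [l], the other end of the chord through [x] is a boundary point nearest to
    [O].  The perpendiculars at both ends are supporting geodesics, the first
    because [x] is farthest and the second by [supporting_nearest], so the
    width at [x] is [l]. *)
Lemma chord_width w : compact K -> constant_width K w -> l = w.
Proof.
move=> Kc Kw.
have [|x Kx xmax] := exists_farthest O Kc; first by exists O; exact: interior_subset.
have [u Ou xE] := exists_gpt O x; have [v nv] := exists_normal Ou.
set M := hdist O x in xmax xE.
have [a [b [a0 b0 bal Kab Bab]]] := chord Ou.
have bM : b = M.
  apply/le_anti/andP; split.
    have : K (gpt O u b) by apply/Kab; rewrite lexx andbT ltW// (lt_trans a0).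
    by move=> /xmax; rewrite hdist_O// gtr0_norm.
  by have /Kab/andP[] : K (gpt O u M) by rewrite -xE.
have ball q : hdist O q < - a -> K° q.
  move=> qa; have [u1 Ou1 qE] := exists_gpt O q.
  have [a1 [b1 [a10 b10 bal1 Kab1 Bab1]]] := chord Ou1.
  have a1M : - a1 <= M.
    have : K (gpt O u1 a1) by apply/Kab1; rewrite lexx ltW// (lt_trans a10).
    by move=> /xmax; rewrite hdist_O// ltr0_norm.
  apply: contrapT; rewrite qE => nq.
  have IO : K° (gpt O u1 0) by rewrite gpt0.
  have [t /andP[t0 tq] /Bab1[]] := crossing_lr Kclosed Ou1 (hdist_ge0 O q) IO nq; lra.
have Ba : boundary K (gpt O u a) by apply/Bab; left.
have Sa : supporting K (geodesic_at (gpt O u a) v).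
  have ON := unit_tangentN Ou.
  have := supporting_nearest ON (unit_normalN nv) Kclosed Kbounded Kconvex _ ball.
  by rewrite gptN// opprK; apply => //; lra.
have [|||Sx Bx] := supporting_farthest Ou nv Kclosed Kbounded (a := 0) (b := b).
- by apply/Kab; rewrite lexx andbT ltW// (lt_trans a0).
- by rewrite lt_eqF.
- by rewrite gpt0// sub0r normrN gtr0_norm// bM.
have ba : b != a by rewrite gt_eqF// (lt_trans a0).
have := width_between Ou nv ba Sx Sa.
rewrite gtr0_norm ?subr_gt0 ?(lt_trans a0)// bal.
exact: constant_widthE Kw Bx.
Qed.

Lemma disc_of_boundary r : (forall p, boundary K p -> hdist O p = r) -> disc K.
Proof.
move=> Kr.
have far u a b : unit_tangent O u -> 0 < b ->
    (forall t, boundary K (gpt O u t) <-> t = a \/ t = b) -> b = r.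
  move=> Ou b0 Bab; rewrite -(Kr (gpt O u b)); last by apply/Bab; right.
  by rewrite hdist_O// gtr0_norm.
exists O, r; split.
  have [u Ou] := exists_unit_tangent O; have [a [b [_ b0 _ _ Bab]]] := chord Ou.
  by rewrite -(far u a b).
apply/seteqP; split => p /=.
  have [u Ou pE] := exists_gpt O p; have [a [b [a0 b0 _ Kab Bab]]] := chord Ou.
  by rewrite {1}pE => /Kab/andP[_]; rewrite (far u a b).
have [u Ou {2}->] := exists_gpt O p; have [a [b [a0 b0 _ Kab Bab]]] := chord Ou.
rewrite -(far u a b)// => pb; apply/Kab; rewrite pb andbT.
by rewrite (le_trans (ltW a0))// hdist_ge0.
Qed.

End Equichordal.

(** * Differentiation along the boundary *)

Section Curve.
Context {R : realType}.
Implicit Types (f g : R -> 'rV[R]_3) (t : R).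

Lemma is_derive_mink f g t : derivable f t 1 -> derivable g t 1 ->
  is_derive t (1 : R) (fun s => mink (f s) (g s))
    (mink ('D_1 f t) (g t) + mink (f t) ('D_1 g t)).
Proof.
move=> df dg; have cf i := (derivable_mxP _ _ _).1 df 0 i.
have cg i := (derivable_mxP _ _ _).1 dg 0 i.
pose F i : R -> R := fun s => f s 0 i * g s 0 i.
have H i : is_derive t (1 : R) (F i)
    (f t 0 i *: 'D_1 (fun s => g s 0 i) t + g t 0 i *: 'D_1 (fun s => f s 0 i) t).
  by apply: is_deriveM; apply: derivableP.
have -> : (fun s => mink (f s) (g s)) = F 1 + F 2 - F 0 by apply/funext.
apply: (is_derive_eq (is_deriveB (is_deriveD (H 1) (H 2)) (H 0))).
by rewrite (derive_mx df) (derive_mx dg) /mink !mxE /GRing.scale/=; ring.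
Qed.

(** At a maximum of the distance from [q], [f] moves perpendicularly to [q]. *)
Lemma deriv_perp_max f q t : (forall s, derivable f s 1) ->
  (forall s, mink (f t) q <= mink (f s) q) -> mink ('D_1 f t) q = 0.
Proof.
move=> df H.
have D s := is_derive_mink (df s) (derivable_cst q s 1).
have D0 : is_derive t (1 : R) (fun s => mink (f s) q) 0.
  apply: (@derive1_at_min R _ (t - 1) (t + 1) t)  => //; first by lra.
  by rewrite in_itv/=; apply/andP; split; lra.
have [_ E] := D t; have [_ E0] := D0.
move: E; rewrite E0 derive_cst => ->.
by rewrite /mink !mxE; ring.
Qed.

Lemma deriv_perp_self f t : (forall s, derivable f s 1) ->
  (forall s, mink (f s) (f s) = -1) -> mink ('D_1 f t) (f t) = 0.
Proof.
move=> df H; have [_] := is_derive_mink (df t) (df t).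
rewrite (_ : (fun _ => _) = cst (-1)); last by apply/funext.
by rewrite derive_cst (minkC (f t)); lra.
Qed.

Lemma mink_cst f q : (forall s, derivable f s 1) ->
  (forall t, mink ('D_1 f t) q = 0) -> forall s t, mink (f s) q = mink (f t) q.
Proof.
move=> df H s t; apply: (is_derive_0_is_cst (f := fun s => mink (f s) q)) => x.
have := is_derive_mink (df x) (derivable_cst q x 1).
rewrite H derive_cst add0r (_ : mink (f x) 0 = 0)//.
by rewrite /mink !mxE; ring.
Qed.

End Curve.

(** * Equichordal bodies of constant width *)

Unset Implicit Arguments.

Theorem corollary4p5 (R : realType) (O : hplane R) (K : set (hplane R)) (w : R)
    (hK : convex_body K)
    (hsmooth : C1_closed_curve (boundary K))
    (hwidth : constant_width K w)
    (hO : interior K O)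
    (hsections : exists l : R, forall G : set (hplane R),
       geodesic G -> G O -> segment_of_length (K `&` G) l) :
  disc K.
Proof.
have [[Kcompact _ KE] Kconvex] := hK.
have Kclosed : closed K by rewrite KE; exact: closed_closure.
have KO := interior_subset hO.
have K0 : K !=set0 by exists O.
have [l Ksec] := hsections.
have [p [q [Kp Kq Kpq]]] := exists_diameter Kcompact K0.
have Kchord := chord Kclosed Kpq Kconvex hO Ksec.
have lw : l = w := chord_width Kclosed Kpq Kconvex hO Ksec Kcompact hwidth.
have pq : p <> q.
  move=> E; rewrite E hdistpp in Kpq; have [u Ou] := exists_unit_tangent O.
  have [a [b [a0 b0 _ Kab _]]] := Kchord u Ou.
  have Kb : K (gpt O u b) by apply/Kab; rewrite lexx andbT ltW// (lt_trans a0).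
  by have := Kpq _ _ KO Kb; rewrite hdist_O// normr_le0 gt_eqF.
have pqw := diameter_width Kclosed Kp Kq pq Kpq hwidth.
rewrite pqw -lw in Kpq.
have [g [dg _ _ _ gB]] := hsmooth.
set f := fun t => set_val (g t) in dg.
(* The radius vector of each boundary point is orthogonal to the boundary: the
   chord through [g t] and [O] is a diameter of [K], and [O] is a linear
   combination of its ends. *)
have fO t : mink ('D_1 f t) (set_val O) = 0.
  have Bt : boundary K (g t) by rewrite -gB; exists t.
  have [u Ou gE] := exists_gpt O (g t).
  have [a [b [a0 b0 bal Kab Bab]]] := Kchord u Ou.
  have tb : hdist O (g t) = b.
    by move: Bt; rewrite {1}gE => /Bab[] // E; have := hdist_ge0 O (g t); lra.
  rewrite tb in gE.
  have Ka : K (gpt O u a) by apply/Kab; rewrite lexx ltW// (lt_trans a0).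
  have l0 : 0 < l by lra.
  have fa : mink ('D_1 f t) (set_val (gpt O u a)) = 0.
    apply: deriv_perp_max => // s; rewrite /f -lerN2.
    have Ks : K (g s).
      by have [] := (boundaryP Kclosed (g s)).1; rewrite // -gB; exists s.
    have := Kpq _ _ Ks Ka; rewrite hdist_le; last exact: ltW.
    by rewrite gE mink_gpt// opprK bal.
  have fb : mink ('D_1 f t) (set_val (gpt O u b)) = 0.
    by rewrite -gE; apply: deriv_perp_self => // s; exact: minkpp.
  have OE : sinh l *: set_val O =
      sinh b *: set_val (gpt O u a) - sinh a *: set_val (gpt O u b).
    rewrite !val_gpt// -bal sinhB !scalerDr !scalerA opprD addrACA -!scalerBl.
    by rewrite (mulrC (sinh a) (sinh b)) subrr scale0r addr0 (mulrC (sinh a)).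
  have /eqP : sinh l * mink ('D_1 f t) (set_val O) = 0.
    by rewrite -minkZr OE -scaleNr minkDr !minkZr fa fb !mulr0 addr0.
  by rewrite mulf_eq0 gt_eqF ?sinh_gt0//= => /eqP.
apply: (disc_of_boundary Kclosed Kpq Kconvex hO Ksec (r := hdist O (g 0))).
move=> x; rewrite -gB => -[t _ <-].
by rewrite /hdist !(minkC (set_val O)) (mink_cst dg fO t 0).
Qed.
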